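(* Let $\Pi=\{\Pi^1,\Pi^2,\dots,\Pi^N\}$ be a set of $N\le d+1$ mutually unbiased observables acting on a complex Hilbert space $\mathcal{H}_d$ with $\dim\mathcal{H}_d=d$, and let $Q(\Pi)$ be its incompatibility as defined in the context. Then $$Q(\Pi)=\left(1-\frac1N\right)\left(1-\frac1d\right).$$
   Context: Let $|\psi^i_j\rangle$, $j=1,\dots,d$, be the normalized eigenvectors of the observable $\Pi^i$ (forming an orthonormal basis of $\mathcal{H}_d$) and let $\Pi^i_j=|\psi^i_j\rangle\langle\psi^i_j|$. The observables $\Pi^1,\dots,\Pi^N$ are mutually unbiased if their eigenbases are mutually unbiased bases, i.e. $$\mathrm{Tr}(\Pi^i_j\Pi^i_k)=\delta_{jk},\qquad \mathrm{Tr}(\Pi^i_j\Pi^k_l)=\frac1d\ \text{ when } i\ne k.$$ The signal ensemble $S(\Pi)$ is the indexed family $\{\Pi^i_j\}_{i=1,\dots,N;\,j=1,\dots,d}$, each state having probability $1/(Nd)$. For a POVM $\mathbf{M}=\{M_a\}$ on $\mathcal{H}_d$ (finitely many positive semidefinite operators with $\sum_a M_a=\mathbb{I}$) and a state reconstruction map $\mathbf{A}:a\mapsto\sigma_a$ assigning to each outcome $a$ a density matrix $\sigma_a$ on $\mathcal{H}_d$, the average fidelity is $$F_{S(\Pi)}(\mathbf{M},\mathbf{A})=\frac{1}{Nd}\sum_{i,j,a}\mathrm{Tr}(\Pi^i_jM_a)\,\mathrm{Tr}(\Pi^i_j\sigma_a).$$ The optimal fidelity is $F_{S(\Pi)}=\sup_{\mathbf{M}}\sup_{\mathbf{A}}F_{S(\Pi)}(\mathbf{M},\mathbf{A})$,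 and the incompatibility of $\Pi$ is $Q(\Pi)=1-F_{S(\Pi)}$. *)

(* Defs.v *)
From HB Require Import structures.
From mathcomp Require Import all_boot all_order all_algebra complex.
From mathcomp Require Import classical_sets reals.
Set Implicit Arguments.
Unset Strict Implicit.
Unset Printing Implicit Defensive.
Import Order.TTheory GRing.Theory Num.Theory.
Local Open Scope ring_scope.
Local Open Scope sesquilinear_scope.
Local Open Scope classical_set_scope.

(* H_d is 'cV[R[i]]_d with the inner product <u|v> = (u^t* *m v) 0 0; operators
   are d x d matrices acting on the left. *)

(* The order on R[i] is partial: 0 <= z means that z is real and nonnegative.
   Over the complex numbers this condition forces A to be Hermitian. *)
Definition psdmx (R : realType) (d : nat) (A : 'M[R[i]]_d) : Prop :=
  forall v : 'cV[R[i]]_d, 0 <= (v^t* *m A *m v) 0 0.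

Definition density_matrix (R : realType) (d : nat) (A : 'M[R[i]]_d) : Prop :=
  psdmx A /\ \tr A = 1.

(* The eigenbasis is part of the data, so that the notions below are also
   meaningful for an operator with repeated eigenvalues. *)
Record observable (R : realType) (d : nat) := Observable {
  obs_op :> 'M[R[i]]_d;
  eigvec : 'I_d -> 'cV[R[i]]_d;
  obs_herm : obs_op \is hermsymmx;
  eigvecP : forall j, exists l : R[i], obs_op *m eigvec j = l *: eigvec j;
  eigvec_orthonormal :
    forall j k, ((eigvec j)^t* *m eigvec k) 0 0 = (j == k)%:R }.

Definition eigproj (R : realType) (d : nat) (P : observable R d) (j : 'I_d) :
    'M[R[i]]_d :=
  eigvec P j *m (eigvec P j)^t*.

Definition mutually_unbiased (R : realType) (d N : nat)
    (P : 'I_N -> observable R d) : Prop :=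
  (forall i j k, \tr (eigproj (P i) j *m eigproj (P i) k) = (j == k)%:R) /\
  (forall i k, i != k ->
     forall j l, \tr (eigproj (P i) j *m eigproj (P k) l) = d%:R^-1).

Record povm (R : realType) (d : nat) := Povm {
  outcomes : nat;
  effect :> 'I_outcomes -> 'M[R[i]]_d;
  effect_psd : forall a, psdmx (effect a);
  effect_sum : \sum_a effect a = 1%:M }.

Record reconstruction (R : realType) (d m : nat) := Reconstruction {
  rec_state :> 'I_m -> 'M[R[i]]_d;
  rec_density : forall a, density_matrix (rec_state a) }.

(* Each trace below is real, being that of a product of two positive
   semidefinite matrices; [complex.Re] only changes the type from R[i] to R. *)
Definition avg_fidelity (R : realType) (d N : nat)
    (P : 'I_N -> observable R d) (M : povm R d)
    (A : reconstruction R d (outcomes M)) : R :=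
  (N * d)%:R^-1 *
  complex.Re (\sum_(i < N) \sum_(j < d) \sum_(a < outcomes M)
    \tr (eigproj (P i) j *m M a) * \tr (eigproj (P i) j *m A a)).

(* For 0 < d both sets of reals are nonempty and consist of values in [0, 1],
   so that each [sup] is a genuine least upper bound. *)
Definition optimal_fidelity (R : realType) (d N : nat)
    (P : 'I_N -> observable R d) : R :=
  sup (range (fun M : povm R d =>
    sup (range (fun A : reconstruction R d (outcomes M) =>
      avg_fidelity P A)))).

Definition incompatibility (R : realType) (d N : nat)
    (P : 'I_N -> observable R d) : R :=
  1 - optimal_fidelity P.

(* Main.v *)
(* Bessel's inequality for the Hilbert-Schmidt inner product: the traceless parts
   of the projections attached to different observables are orthogonal, so the
   projection of a positive A on the span of all E_ij has squared norm
   sum_ij Tr(E_ij A)^2 - (N-1) (Tr A)^2 / d, which is at most Tr(A^2) <= (Tr A)^2.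
   AM-GM turns the bounds for A = M_a and A = sigma_a into
   sum_ij Tr(E_ij M_a) Tr(E_ij sigma_a) <= (1 + (N-1)/d) Tr M_a, and summing over
   a bounds the fidelity by (N+d-1)/(Nd).  Measuring one of the observables and
   preparing the observed eigenstate attains this value. *)

Require Import Defs.
From mathcomp Require Import all_boot all_order all_algebra complex.
From mathcomp Require Import classical_sets reals.
From mathcomp Require Import ring.
Set Implicit Arguments.
Unset Strict Implicit.
Unset Printing Implicit Defensive.
Import Order.TTheory GRing.Theory Num.Theory.
Local Open Scope ring_scope.
Local Open Scope sesquilinear_scope.

(** * Adjoints and positive semidefinite matrices *)

Lemma adjmxM (C : numClosedFieldType) m n p (A : 'M[C]_(m, n)) (B : 'M[C]_(n, p)) :
  (A *m B)^t* = B^t* *m A^t*.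
Proof. by rewrite trmx_mul map_mxM. Qed.

Lemma adjmxD (C : numClosedFieldType) m n (A B : 'M[C]_(m, n)) :
  (A + B)^t* = A^t* + B^t*.
Proof. by apply/matrixP=> i j; rewrite !mxE rmorphD. Qed.

Lemma adjmxZ (C : numClosedFieldType) m n (a : C) (A : 'M[C]_(m, n)) :
  (a *: A)^t* = a^* *: A^t*.
Proof. by apply/matrixP=> i j; rewrite !mxE rmorphM. Qed.

Lemma mxtrace_mul_adj_ge0 (C : numClosedFieldType) n (A : 'M[C]_n) :
  0 <= \tr (A *m A^t*).
Proof.
apply: sumr_ge0 => i _; rewrite mxE; apply: sumr_ge0 => j _.
by rewrite !mxE mul_conjC_ge0.
Qed.

(** Polarization: the quadratic form is real at [e j + s *: e i], and the cases s = 1 and s = i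
    together force [A i j] to be the conjugate of [A j i]. *)
Lemma psdmx_adj (R : realType) d (A : 'M[R[i]]_d) : psdmx A -> A^t* = A.
Proof.
move=> Apsd; apply/matrixP=> i j; rewrite !mxE.
pose e k : 'cV[R[i]]_d := delta_mx k 0.
have eA k l : (e k)^t* *m A *m e l = (A k l)%:M.
  rewrite trmx_delta map_delta_mx -rowE -colE.
  by apply/matrixP=> x y; rewrite !ord1 !mxE eqxx.
have Akk k : A k k \is Num.real.
  by apply: ger0_real; have := Apsd (e k); rewrite eA mxE eqxx.
have polar s : s * A j i + s^* * A i j \is Num.real.
  have := ger0_real (Apsd (e j + s *: e i)).
  rewrite adjmxD adjmxZ !mulmxDl !mulmxDr -!scalemxAl.
  rewrite -!scalemxAr !eA !mxE eqxx !mulr1n.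
  have -> : A j j + s * A j i + (s^* * A i j + s^* * (s * A i i)) =
    (A j j + s * s^* * A i i) + (s * A j i + s^* * A i j) by ring.
  rewrite rpredDl // realD // realM //; apply: ger0_real; exact: mul_conjC_ge0.
have /CrealP := polar 1; rewrite conjC1 !mul1r rmorphD /= => e1.
have /CrealP := polar 'i; rewrite conjCi rmorphD !rmorphM rmorphN /= conjCi.
rewrite opprK => e2.
have {}e2 : (A i j)^* - (A j i)^* = A j i - A i j.
  by apply: (mulfI (@neq0Ci R[i])); rewrite !mulrBr addrC -mulNr e2 mulNr.
have /eqP : (A j i)^* *+ 2 = A i j *+ 2.
  have -> : (A j i)^* *+ 2 = ((A j i)^* + (A i j)^*) - ((A i j)^* - (A j i)^*).
    by ring.
  by rewrite e1 e2; ring.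
by rewrite eqrMn2r /= => /eqP.
Qed.

(** The eigenvalues are nonnegative, so the sum of their squares is at most the square of their
    sum. *)
Lemma psdmx_mxtrace_sqr (R : realType) d (A : 'M[R[i]]_d) :
  psdmx A -> \tr (A *m A) <= (\tr A) ^+ 2.
Proof.
move=> Apsd.
have /hermitian_normalmx/orthomx_spectralP : A \is hermsymmx.
  by apply/is_hermitianmxP; rewrite expr0 scale1r psdmx_adj.
set U := spectralmx A; set D := spectral_diag A => AE.
have Uu : U \is unitarymx := spectral_unitarymx A.
have Uv : U \in unitmx := spectral_unit A.
(* An eigenvalue is the value of the form at a column of [U^t*], a unit eigenvector. *)
have D0 k : 0 <= D 0 k.
  have := Apsd (U^t* *m delta_mx k 0).
  rewrite {1}AE invmx_unitary // adjmxM trmxCK.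
  rewrite -!mulmxA (mulmxA U (U^t*)) (unitarymxP Uu) mul1mx (mulmxA U).
  rewrite (unitarymxP Uu) mul1mx trmx_delta map_delta_mx mulmxA -rowE -colE.
  by rewrite !mxE eqxx mulr1n.
have trA : \tr A = \sum_k D 0 k.
  by rewrite AE mxtrace_mulC mulmxA mulmxV // mul1mx mxtrace_diag.
have -> : \tr (A *m A) = \sum_k D 0 k * D 0 k.
  rewrite AE !mulmxA mulmxK // mxtrace_mulC !mulmxA mulmxV // mul1mx.
  rewrite mulmx_diag mxtrace_diag.
  by apply: eq_bigr => k _; rewrite mxE.
rewrite trA expr2 mulr_suml; apply: ler_sum => k _.
apply: ler_wpM2l => //; rewrite (bigD1 k) //= lerDl; exact: sumr_ge0.
Qed.

(** * Projections onto the eigenvectors of one observable *)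

Section Eigenprojections.
Variables (R : realType) (d : nat).
Implicit Types (P : observable R d) (A : 'M[R[i]]_d).

Lemma eigproj_adj P j : (eigproj P j)^t* = eigproj P j.
Proof. by rewrite /eigproj adjmxM trmxCK. Qed.

Lemma mxtrace_eigproj_mul P j A :
  \tr (eigproj P j *m A) = ((eigvec P j)^t* *m A *m eigvec P j) 0 0.
Proof. by rewrite /eigproj -mulmxA mxtrace_mulC trace_mx11. Qed.

Lemma mxtrace_eigproj_mul_ge0 P j A : psdmx A -> 0 <= \tr (eigproj P j *m A).
Proof. by move=> Apsd; rewrite mxtrace_eigproj_mul. Qed.

Lemma mxtrace_eigproj P j : \tr (eigproj P j) = 1.
Proof.
by rewrite -[eigproj P j]mulmx1 mxtrace_eigproj_mul mulmx1 eigvec_orthonormal eqxx.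
Qed.

Lemma psdmx_eigproj P j : psdmx (eigproj P j).
Proof.
move=> v; set x := ((eigvec P j)^t* *m v) 0 0.
suff -> : (v^t* *m eigproj P j *m v) 0 0 = x^* * x by rewrite mulrC mul_conjC_ge0.
rewrite /eigproj mulmxA -mulmxA mxE big_ord1; congr (_ * _).
have -> : v^t* *m eigvec P j = ((eigvec P j)^t* *m v)^t* by rewrite adjmxM trmxCK.
by rewrite 2!mxE.
Qed.

(** Orthonormality makes [V^t*] a left inverse of the square matrix [V] of eigenvectors, hence a
    right inverse; [V *m V^t*] is the sum of the projections. *)
Lemma sum_eigproj P : \sum_j eigproj P j = 1%:M.
Proof.
pose V := \matrix_(i, j) eigvec P j i 0.
have VV : V^t* *m V = 1%:M.
  apply/matrixP=> j k; rewrite mxE [RHS]mxE -(eigvec_orthonormal P) mxE.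
  by apply: eq_bigr => i _; rewrite !mxE.
rewrite -(mulmx1C VV); apply/matrixP=> i k; rewrite summxE mxE.
by apply: eq_bigr => j _; rewrite !mxE big_ord1 !mxE.
Qed.

Lemma sum_mxtrace_eigproj_mul P A : \sum_j \tr (eigproj P j *m A) = \tr A.
Proof. by rewrite -raddf_sum /= -mulmx_suml sum_eigproj mul1mx. Qed.

End Eigenprojections.

(** * Bessel's inequality for mutually unbiased bases *)

Lemma mub_bessel (R : realType) (d N : nat) (hd : (0 < d)%N)
    (P : 'I_N -> observable R d) (hP : mutually_unbiased P) (A : 'M[R[i]]_d) :
  psdmx A ->
  \sum_i \sum_j (\tr (eigproj (P i) j *m A)) ^+ 2
    <= (1 + (N%:R - 1) / d%:R) * (\tr A) ^+ 2.
Proof.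
move=> Apsd; have d0 : d%:R != 0 :> R[i] by rewrite pnatr_eq0 -lt0n.
pose E i j := eigproj (P i) j.
pose p i j := \tr (E i j *m A); set t := \tr A.
(* Each of the [N] observables contributes the identity component [t / d] of [A] to the double sum
   in [W]; [e] removes the N - 1 surplus copies. *)
pose e := (N%:R - 1) * t / d%:R.
(* W is the Hilbert-Schmidt projection of A on the span of the E i j. *)
pose W := \sum_i \sum_j p i j *: E i j - e%:M.
set S := \sum_i \sum_j _.
have trWM B : \tr (W *m B) = \sum_i \sum_j p i j * \tr (E i j *m B) - e * \tr B.
  rewrite mulmxBl mul_scalar_mx linearB linearZ /=; congr (_ - _).
  rewrite mulmx_suml raddf_sum; apply: eq_bigr => i _ /=.
  rewrite mulmx_suml raddf_sum; apply: eq_bigr => j _ /=.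
  by rewrite -scalemxAl linearZ.
have trW : \tr W = t.
  have := trWM 1%:M; rewrite mulmx1 mxtrace1 => ->.
  have -> : \sum_i \sum_j p i j * \tr (E i j *m 1%:M) = \sum_(i < N) t.
    apply: eq_bigr => i _; rewrite /t -(sum_mxtrace_eigproj_mul (P i)).
    by apply: eq_bigr => j _; rewrite mulmx1 mxtrace_eigproj mulr1.
  by rewrite sumr_const card_ord /e mulfVK // -mulr_natl; ring.
have trWA : \tr (W *m A) = S - e * t.
  by rewrite trWM; congr (_ - _); apply: eq_bigr => i _; apply: eq_bigr.
(* [A - W] is orthogonal to every [E k l]: the basis [k] yields [p k l], and each other basis yields
   [t / d], which [e] cancels. *)
have trWE k l : \tr (E k l *m W) = p k l.
  rewrite mxtrace_mulC trWM mxtrace_eigproj mulr1 (bigD1 k) //= (bigD1 l) //=.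
  rewrite (proj1 hP) eqxx mulr1 big1 ?addr0; last first.
    by move=> j jl; rewrite (proj1 hP) (negbTE jl) mulr0.
  rewrite (eq_bigr (fun=> t / d%:R)); last first.
    move=> i ik; rewrite /t -(sum_mxtrace_eigproj_mul (P i)) mulr_suml.
    by apply: eq_bigr => j _; rewrite (proj2 hP).
  rewrite sumr_const cardC1 card_ord /e -addrA -[_ / _ *+ _]mulr_natl.
  (* The index [k] excludes N = 0, where the truncated predecessor would differ. *)
  have -> : N.-1%:R = N%:R - 1 :> R[i].
    by case: (N) k => [[]|n] // _; rewrite -natr1 addrK.
  by rewrite mulrA subrr addr0.
have trWW : \tr (W *m W) = S - e * t.
  rewrite trWM trW; congr (_ - _); apply: eq_bigr => i _; apply: eq_bigr => j _.
  by rewrite trWE.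
(* The coefficients [p i j] and [e] are real, so [W] is Hermitian and the trace of the square of
   [A - W] is its squared norm. *)
have Wadj : W^t* = W.
  apply/matrixP=> x y; rewrite !mxE !summxE rmorphB rmorph_sum /=.
  congr (_ - _).
    apply: eq_bigr => i _; rewrite !summxE rmorph_sum; apply: eq_bigr => j _ /=.
    rewrite [X in X^*]mxE [RHS]mxE rmorphM /=.
    rewrite (CrealP (ger0_real (mxtrace_eigproj_mul_ge0 _ _ Apsd))).
    by have /matrixP/(_ x y) := eigproj_adj (P i) j; rewrite mxE mxE => ->.
  have tadj : t^* = t.
    by rewrite /t -[in RHS](psdmx_adj Apsd) trace_map_mx mxtrace_tr.
  have ereal : e^* = e.
    by rewrite /e !rmorphM fmorphV rmorphB /= tadj conjC1 !conjC_nat.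
  by rewrite eq_sym; case: (x == y); rewrite ?mulr1n ?mulr0n ?conjC0.
(* Since Tr(WA) = Tr(WW), expanding the squared norm of [A - W] leaves Tr(AA) - (S - e t) >= 0. *)
clearbody W; have := mxtrace_mul_adj_ge0 (A - W).
have -> : (A - W)^t* = A - W.
  by rewrite adjmxD -scaleN1r adjmxZ rmorphN1 psdmx_adj ?Wadj.
rewrite mulmxBl !mulmxBr !linearB /= (mxtrace_mulC A W) trWA trWW.
rewrite [X in 0 <= X -> _](_ : _ = \tr (A *m A) - (S - e * t)); last by ring.
rewrite subr_ge0 => /le_trans /(_ (psdmx_mxtrace_sqr Apsd)).
rewrite lerBlDr => /le_trans -> //; rewrite le_eqVlt; apply/predU1P; left.
by rewrite /e; field.
Qed.

(** Weighting [q] by t = Tr A turns both Bessel bounds into c t^2, because Tr B = 1. Summing 2 t p q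
    <= p^2 + t^2 q^2 and dividing by 2 t gives the claim. *)
Lemma mub_fidelity_term_le (R : realType) (d N : nat) (hd : (0 < d)%N)
    (hN : (0 < N)%N) (P : 'I_N -> observable R d) (hP : mutually_unbiased P)
    (A B : 'M[R[i]]_d) :
  psdmx A -> density_matrix B ->
  \sum_i \sum_j \tr (eigproj (P i) j *m A) * \tr (eigproj (P i) j *m B)
    <= (1 + (N%:R - 1) / d%:R) * \tr A.
Proof.
move=> Apsd [Bpsd trB]; set t := \tr A; set c := 1 + _.
pose p i j := \tr (eigproj (P i) j *m A); pose q i j := \tr (eigproj (P i) j *m B).
have p0 i j : 0 <= p i j by exact: mxtrace_eigproj_mul_ge0.
have q0 i j : 0 <= q i j by exact: mxtrace_eigproj_mul_ge0.
have tE i : t = \sum_j p i j by rewrite sum_mxtrace_eigproj_mul.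
have : 0 <= t by rewrite (tE (Ordinal hN)); exact: sumr_ge0.
rewrite le_eqVlt => /predU1P[t0|t0].
  (* When t = 0, the nonnegative [p i j] sum to 0 over [j], so all of them vanish. *)
  rewrite -t0 mulr0 big1 // => i _; rewrite big1 // => j _.
  have /eqP := tE i; rewrite -t0 eq_sym psumr_eq0 // => /allP/(_ j).
  by rewrite mem_index_enum => /(_ isT) /eqP; rewrite /p => ->; rewrite mul0r.
have amgm i j : p i j * q i j *+ 2 * t <= p i j ^+ 2 + t ^+ 2 * q i j ^+ 2.
  rewrite -subr_ge0.
  have -> : p i j ^+ 2 + t ^+ 2 * q i j ^+ 2 - p i j * q i j *+ 2 * t =
    (p i j - t * q i j) ^+ 2 by ring.
  (* In [R[i]] a square is nonnegative exactly when its base is real. *)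
  by rewrite -realEsqr rpredB // ?rpredM //; apply: ger0_real; rewrite // ltW.
have bA := mub_bessel hd hP Apsd; have := mub_bessel hd hP Bpsd.
rewrite trB expr1n mulr1 -(ler_pM2l (exprn_gt0 2 t0)) => /(lerD bA) bAB.
rewrite -(ler_pM2r t0) -(@ler_pMn2r _ 2) // (le_trans _ (le_trans bAB _)) //.
  rewrite mulr_suml -sumrMnl mulr_sumr -big_split; apply: ler_sum => i _ /=.
  rewrite mulr_suml -sumrMnl mulr_sumr -big_split; apply: ler_sum => j _ /=.
  by rewrite -mulrnAl; exact: amgm.
by rewrite le_eqVlt; apply/predU1P; left; rewrite -/t -/c; ring.
Qed.

(** * The optimal fidelity: upper bound and attainment *)

Section OptimalFidelity.
Variables (R : realType) (d N : nat).
Hypotheses (hd : (0 < d)%N) (hN : (0 < N)%N).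
Variable P : 'I_N -> observable R d.
Hypothesis hP : mutually_unbiased P.

Let F : R := (N%:R + d%:R - 1) / (N%:R * d%:R).

Lemma avg_fidelity_le (M : povm R d) (A : reconstruction R d (outcomes M)) :
  avg_fidelity P A <= F.
Proof.
have d0 : d%:R != 0 :> R by rewrite pnatr_eq0 -lt0n.
have N0 : N%:R != 0 :> R by rewrite pnatr_eq0 -lt0n.
have d0C : d%:R != 0 :> R[i] by rewrite pnatr_eq0 -lt0n.
rewrite /avg_fidelity mulrC ler_pdivrMr ?ltr0n ?muln_gt0 ?hN //.
have -> : F * (N * d)%:R = complex.Re ((N%:R + d%:R - 1)%:C)%C.
  by rewrite /F natrM /= divfK // mulf_neq0.
set s := \sum_(i < N) _.
(* The order on [R[i]] entails the order of real parts, so the estimate can be made in [R[i]]. *)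
suff : s <= ((N%:R + d%:R - 1)%:C)%C by rewrite lecE => /andP[].
have -> : s = \sum_a \sum_i \sum_j
    \tr (eigproj (P i) j *m M a) * \tr (eigproj (P i) j *m A a).
  by rewrite exchange_big; apply: eq_bigr => i _; rewrite exchange_big.
apply: (@le_trans _ _ (\sum_a (1 + (N%:R - 1) / d%:R) * \tr (M a))).
  apply: ler_sum => a _; apply: mub_fidelity_term_le => //.
    exact: effect_psd.
  exact: rec_density.
rewrite -mulr_sumr -raddf_sum effect_sum /= mxtrace1 rmorphB rmorphD.
by rewrite !rmorph_nat rmorph1 le_eqVlt; apply/predU1P; left; field.
Qed.

Let eigen_povm (k : 'I_N) : povm R d :=
  Povm (fun j => psdmx_eigproj (P k) (j : 'I_d)) (sum_eigproj (P k)).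

Lemma eigproj_density (Q : observable R d) j : density_matrix (eigproj Q j).
Proof. by split; [exact: psdmx_eigproj | exact: mxtrace_eigproj]. Qed.

Let eigen_reconstruction (k : 'I_N) : reconstruction R d (outcomes (eigen_povm k)) :=
  Reconstruction (fun j : 'I_d => eigproj_density (P k) j).

(** The measured observable contributes 1 for each of its [d] eigenstates; each of the other N - 1
    contributes d^2 terms 1/d^2, that is 1 in total. *)
Lemma avg_fidelity_eigen k : avg_fidelity P (eigen_reconstruction k) = F.
Proof.
have d0C : d%:R != 0 :> R[i] by rewrite pnatr_eq0 -lt0n.
rewrite /avg_fidelity (bigD1 k) //= (eq_bigr (fun=> 1)); last first.
  move=> j _; rewrite (bigD1 j) //= (proj1 hP) eqxx mulr1 big1 ?addr0 //.
  by move=> l lj; rewrite (proj1 hP) eq_sym (negbTE lj) mul0r.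
rewrite [X in _ + X](eq_bigr (fun=> 1)); last first.
  move=> i ik; under eq_bigr do under eq_bigr do rewrite !(proj2 hP) //.
  by rewrite !sumr_const !card_ord; field.
rewrite !sumr_const cardC1 !card_ord -natrD.
have -> : complex.Re (d + N.-1)%:R = (d + N.-1)%:R :> R.
  by rewrite -(rmorph_nat (real_complex R)).
have -> : (d + N.-1)%:R = N%:R + d%:R - 1 :> R.
  by rewrite -[in RHS](prednK hN) -natr1 natrD; ring.
by rewrite /F natrM mulrC.
Qed.

Lemma optimal_fidelity_mub : optimal_fidelity P = F.
Proof.
pose k := Ordinal hN.
have inner_le (M : povm R d) :
    sup (range (fun A : reconstruction R d (outcomes M) => avg_fidelity P A)) <= F.
  apply: ge_sup => [|_ [A _ <-]]; last exact: avg_fidelity_le.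
  (* A constant guess exists for every POVM and shows that the inner set is nonempty. *)
  pose A0 := Reconstruction
    (fun _ : 'I_(outcomes M) => eigproj_density (P k) (Ordinal hd)).
  by exists (avg_fidelity P A0); exists A0.
apply/eqP; rewrite eq_le; apply/andP; split.
  apply: ge_sup => [|_ [M _ <-]]; last exact: inner_le.
  by eexists; exists (eigen_povm k).
apply: (@le_trans _ _ (sup (range
    (fun A : reconstruction R d (outcomes (eigen_povm k)) => avg_fidelity P A)))).
  rewrite -(avg_fidelity_eigen k); apply: ub_le_sup.
    by exists F => _ [A _ <-]; exact: avg_fidelity_le.
  by exists (eigen_reconstruction k).
apply: ub_le_sup; first by exists F => _ [M _ <-]; exact: inner_le.
by exists (eigen_povm k).
Qed.

End OptimalFidelity.

Theorem theorem3 (R : realType) (d N : nat) (hd : (0 < d)%N) (hN : (0 < N)%N)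
    (hNd : (N <= d.+1)%N) (P : 'I_N -> observable R d)
    (hP : mutually_unbiased P) :
  incompatibility P = (1 - N%:R^-1) * (1 - d%:R^-1).
Proof.
(* The identity is Nd - (N + d - 1) = (N - 1)(d - 1), divided by Nd. *)
rewrite /incompatibility optimal_fidelity_mub //; field.
by rewrite !pnatr_eq0 -!lt0n hd hN.
Qed.
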